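(* Let $H:\mathbb{R}^{2m}\to\mathbb{R}$ be smooth, let $\bar\nabla H$ be the coordinate increment discrete gradient of $H$, and let $\bar y\in\mathbb{R}^{2m}$. The numerical scheme $$y_{n+1}-y_n=\theta_n\,S\,\bar\nabla H(y_n,y_{n+1}),\qquad \theta_n=2\left(SR+F'\coth\frac{h_nF'}{2}\right)^{-1},$$ where $F'=S\,H_{yy}$ and $R$ is the skew-symmetric $2m\times2m$ matrix with entries $R_{jk}=H_{y^jy^k}$ for $j>k$, $R_{jj}=0$, $R_{jk}=-H_{y^jy^k}$ for $j<k$ ($F'$ and $R$ evaluated at $y=\bar y$, and $h_n>0$ sufficiently small that $\theta_n$ is defined), is energy-preserving, i.e. $H(y_{n+1})=H(y_n)$ whenever $y_n,y_{n+1}$ satisfy the scheme. (Here $\bar y$ may be any point, possibly depending on $y_n,y_{n+1}$.)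
   Context: Here $y=(x^1,\dots,x^m,p^1,\dots,p^m)^T\in\mathbb{R}^{2m}$ are canonical coordinates, $S=\begin{pmatrix}0&I\\-I&0\end{pmatrix}$, $H_{yy}$ is the Hessian of $H$, $H_{y^jy^k}=\partial^2H/\partial y^j\partial y^k$, and $F'=SH_{yy}$ is the Jacobi matrix of the right-hand side $F=SH_y$ of Hamilton's equations. The expression $F'\coth\frac{h_nF'}{2}$ is understood as $g(F')$ with $g(z)=z\coth\frac{h_nz}{2}$, $g(0)=2/h_n$ (analytic at $0$). Coordinate increment discrete gradient: $\bar\nabla H=\left(\frac{\Delta H}{\Delta y^1},\dots,\frac{\Delta H}{\Delta y^{2m}}\right)$ (treated as a column vector), $$\frac{\Delta H}{\Delta y^j}=\frac{H(y_{n+1}^1,\dots,y_{n+1}^{j},y_n^{j+1},\dots,y_n^{2m})-H(y_{n+1}^1,\dots,y_{n+1}^{j-1},y_n^{j},\dots,y_n^{2m})}{y_{n+1}^j-y_n^j},$$ with the limit value (partial derivative $\partial H/\partial y^j$ at the corresponding point) taken when $y_{n+1}^j=y_n^j$. *)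

(* Defs.v *)
From HB Require Import structures.
From mathcomp Require Import all_boot all_order all_algebra.
From mathcomp Require Import complex.
From mathcomp Require Import all_classical all_reals all_analysis.

Set Implicit Arguments.
Unset Strict Implicit.
Unset Printing Implicit Defensive.

Import Order.TTheory GRing.Theory Num.Theory numFieldNormedType.Exports.

Local Open Scope classical_set_scope.
Local Open Scope ring_scope.
Local Open Scope complex_scope.

Section PrimaryMatrixFunction.
Variables (K : numClosedFieldType) (n : nat).
Implicit Types (f : K -> K) (A : 'M[K]_n.+1) (p : {poly K}).

(* The exponent [mup a (mxminpoly A)] is the size of the largest Jordan block
   of A for the eigenvalue a (0 if a is not an eigenvalue). *)
Definition interpolates_on_spectrum f A p :=
  forall (a : K) (k : nat), (k < mup a (mxminpoly A))%N ->
    (p^`(k)).[a] = derive1n k f a.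

(* f(A) is p(A) for any Hermite interpolation polynomial p of f on the spectrum
   of A. Such a p always exists, and two of them differ by a multiple of the
   minimal polynomial of A, so neither the default value nor the choice made by
   [xget] matters. The value is meaningful when
   [holomorphic_on_spectrum f A] holds. *)
Definition mxfun f A : 'M[K]_n.+1 :=
  horner_mx A (xget 0 [set p | interpolates_on_spectrum f A p]).

Definition holomorphic_on_spectrum f A :=
  forall a : K, eigenvalue A a -> \forall z \near a, derivable f z 1.

End PrimaryMatrixFunction.

Section ComplexCoth.
Variable R : realType.
Implicit Types (z : R[i]) (h : R).

Definition cexp z : R[i] :=
  (expR (complex.Re z))%:C * (cos (complex.Im z) +i* sin (complex.Im z)).

Definition ccoth z : R[i] := (cexp z + cexp (- z)) / (cexp z - cexp (- z)).

(* Since [_ / 0 = 0], this function also takes finite values at the poles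
   2 pi i k / h, k != 0; it is not continuous there, so
   [holomorphic_on_spectrum] excludes them. *)
Definition zcoth h z : R[i] :=
  if z == 0 then (2 / h)%:C else z * ccoth (h%:C * z / 2).

End ComplexCoth.

Section Calculus.
Variables (R : realType) (n : nat).
Implicit Types (H : 'cV[R]_n -> R) (y : 'cV[R]_n).

Definition partial (j : 'I_n) H : 'cV[R]_n -> R :=
  fun y => 'D_(delta_mx j 0) H y.

Definition iter_partial (s : seq 'I_n) H : 'cV[R]_n -> R := foldr partial H s.

Definition smooth H :=
  forall s : seq 'I_n,
    continuous (iter_partial s H) /\
    forall j y, derivable (iter_partial s H) y (delta_mx j 0).

Definition hessian H y : 'M[R]_n :=
  \matrix_(j, k) partial j (partial k H) y.

(* first k coordinates from y1, the other ones from y0 *)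
Definition mixed_point (y0 y1 : 'cV[R]_n) (k : nat) : 'cV[R]_n :=
  \col_i (if (i < k)%N then y1 i 0 else y0 i 0).

Definition coord_increment_dgrad H (y0 y1 : 'cV[R]_n) : 'cV[R]_n :=
  \col_j (if y1 j 0 == y0 j 0 then partial j H (mixed_point y0 y1 j)
          else (H (mixed_point y0 y1 j.+1) - H (mixed_point y0 y1 j))
               / (y1 j 0 - y0 j 0)).

Definition skew_hessian H y : 'M[R]_n :=
  \matrix_(j, k) (if (k < j)%N then hessian H y j k
                  else if (j < k)%N then - hessian H y j k else 0).

End Calculus.

Definition symplectic_mx (R : realType) (m : nat) : 'M[R]_(m + m) :=
  block_mx 0 1%:M (- 1%:M) 0.

Section Scheme.
Variables (R : realType) (m : nat).
Let N := (m.+1 + m.+1)%N.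
Implicit Types (H : 'cV[R]_N -> R) (y : 'cV[R]_N) (h : R).

Definition hamiltonian_jacobi H y : 'M[R]_N :=
  symplectic_mx R m.+1 *m hessian H y.

Definition complexify p q (A : 'M[R]_(p, q)) : 'M[R[i]]_(p, q) :=
  map_mx (real_complex R) A.

(* SR + F' coth (h F' / 2). The eigenvalues of F' are complex in general, so
   this (real) matrix is computed over R[i]. *)
Definition theta_denom H h y : 'M[R[i]]_N :=
  complexify (symplectic_mx R m.+1 *m skew_hessian H y)
  + mxfun (zcoth h) (complexify (hamiltonian_jacobi H y)).

Definition theta_defined H h y :=
  holomorphic_on_spectrum (zcoth h) (complexify (hamiltonian_jacobi H y))
  /\ theta_denom H h y \in unitmx.

Definition theta H h y : 'M[R[i]]_N := 2 *: invmx (theta_denom H h y).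

Definition dg_scheme H h (ybar y0 y1 : 'cV[R]_N) :=
  complexify (y1 - y0) =
    theta H h ybar
      *m complexify (symplectic_mx R m.+1 *m coord_increment_dgrad H y0 y1).

End Scheme.

(* Main.v *)
Require Import Defs.
From mathcomp Require Import all_boot all_order all_algebra.
From mathcomp Require Import complex ring.
From mathcomp Require Import all_classical all_reals all_analysis.

Set Implicit Arguments.
Unset Strict Implicit.
Unset Printing Implicit Defensive.

Import Order.TTheory GRing.Theory Num.Theory numFieldNormedType.Exports.

Local Open Scope classical_set_scope.
Local Open Scope ring_scope.
Local Open Scope complex_scope.

(** Write d = y1 - y0, let g be the discrete gradient and let D = S R + M, with
    M = F' coth (h F' / 2), be the matrix inverted in theta. The scheme says that
    D d = 2 S g. As S S = -1, multiplying by - S turns this into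
      2 g = (R - S M) d,
    while the increments of H along the coordinate path from y0 to y1 telescope
    to d^T g = H(y1) - H(y0) ([coord_increment_dgradP]). Energy preservation thus
    follows once R - S M is skew-symmetric, since then d^T (R - S M) d = 0.

    R is skew because the Hessian is symmetric, which is Schwarz's theorem
    ([derive_comm]); it is proved by applying the mean value theorem twice to the
    second difference of f over a small parallelogram, in both orders.

    S M is skew because z coth (h z / 2) is even and F' = S H_yy is Hamiltonian:
    S F' = - F'^T S. For any polynomial p this gives S p(F') = p(-F')^T S, so it
    remains to see that M = p(F') for some p with p(-F') = p(F'). If p
    interpolates an even function on the spectrum of F', so does p(-X): the k-th
    derivatives of both the function and p(-X) at a are (-1)^k times those of the
    function and p at -a, and a and -a have the same multiplicity in the minimal
    polynomial, F' being similar to - F'^T. Two interpolating polynomials agree at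
    F', because their difference vanishes to the required order at every root of
    the minimal polynomial and is hence a multiple of it ([dvdp_hermite]). So
    p(-F') = p(F') ([mul_mxfun_even]). *)

(** * Hermite interpolation and divisibility *)

(** Taylor's formula at a, read in {poly K}: p is the sum of the
    p^`N(i).[a] *: ('X - a%:P) ^+ i. *)
Lemma dvdp_exp_XsubC_derivn (K : numFieldType) (p : {poly K}) (a : K) (n : nat) :
  (forall k, (k < n)%N -> (p^`(k)).[a] = 0) -> ('X - a%:P) ^+ n %| p.
Proof.
move=> p0; rewrite -(comp_polyXr p) /comp_poly -{2}(subrKC a%:P 'X).
rewrite nderiv_taylor; last exact: mulrC.
elim/big_rec: _ => [|i q _ dq]; first exact: dvdp0.
rewrite dvdp_addl //; have [ni|] := leqP n i.
  exact/dvdp_mull/dvdp_exp2l.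
move=> /p0; rewrite nderivn_def hornerMn nderivn_map horner_map => /eqP.
by rewrite mulrn_eq0 -leqn0 leqNgt fact_gt0 => /eqP ->; rewrite mul0r dvdp0.
Qed.

(** Over a closed field the lists of roots determine divisibility: multiplicities
    compare pointwise exactly when one list is a sublist of a permutation of the
    other. *)
Lemma dvdp_mup_le (K : closedFieldType) (p q : {poly K}) :
  p != 0 -> q != 0 -> (forall a, (mup a p <= mup a q)%N) -> p %| q.
Proof.
move=> p0 q0.
have [s ps] := closed_field_poly_normal p.
have [t qt] := closed_field_poly_normal q.
have mupZ r (l : {poly K}) a : l = lead_coef l *: \prod_(z <- r) ('X - z%:P) ->
    l != 0 -> mup a l = count_mem a r.
  move=> -> l0; rewrite -mul_polyC mupMr ?mu_prod_XsubC // rootC.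
  by move: l0; rewrite scaler_eq0 negb_or => /andP[].
move=> pq; have /count_subseqP[u ut su] : forall a, (count_mem a s <= count_mem a t)%N.
  by move=> a; rewrite -(mupZ _ _ a ps p0) -(mupZ _ _ a qt q0).
have [v tv] := perm_to_subseq ut.
rewrite ps qt dvdpZl ?lead_coef_eq0 // dvdpZr ?lead_coef_eq0 //.
by rewrite (perm_big _ su) (perm_big _ tv) big_cat dvdp_mulr.
Qed.

(** The uniqueness part of Hermite interpolation, applied to the difference of
    two interpolating polynomials. *)
Lemma dvdp_hermite (K : numClosedFieldType) (p q : {poly K}) : p != 0 ->
  (forall a k, (k < mup a p)%N -> (q^`(k)).[a] = 0) -> p %| q.
Proof.
move=> p0 pq; have [->|q0] := eqVneq q 0; first exact: dvdp0.
apply: dvdp_mup_le => // a; rewrite mup_geq //.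
by apply: dvdp_exp_XsubC_derivn => k; exact: pq.
Qed.

Lemma derivn_comp_polyNX (R : comNzRingType) (p : {poly R}) (k : nat) :
  (p \Po - 'X)^`(k) = (-1) ^+ k *: (p^`(k) \Po - 'X).
Proof.
elim: k => [|k IHk]; first by rewrite expr0 scale1r.
rewrite !derivnS IHk derivZ deriv_comp derivN derivX mulrN1.
by rewrite exprSr scalerN mulrN1 scaleNr.
Qed.

Lemma comp_polyNXK (R : comNzRingType) (p : {poly R}) : (p \Po - 'X) \Po - 'X = p.
Proof. by rewrite -comp_polyA rmorphN /= comp_polyX opprK comp_polyXr. Qed.

(** * Derivatives of even functions *)

(** The difference quotient of f at - x with step h is, up to the sign, the one at
    x with step - h. No differentiability is assumed, so that the parity can be
    propagated to all the iterated derivatives. *)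
Lemma derive1_parity (K : numFieldType) (f : K -> K) (k : nat) :
  (forall x, f (- x) = (-1) ^+ k * f x) ->
  forall x, f^`()%classic (- x) = (-1) ^+ k.+1 * f^`()%classic x.
Proof.
move=> fN x; pose q y (h : K) : K := h^-1 *: (f (h + y) - f y).
have qN : q (- x) = (fun h => (-1) ^+ k.+1 * q x (- h)).
  apply/funext => h; rewrite /q -[h in h - x]opprK -opprD !fN invrN exprS.
  by rewrite /GRing.scale /=; ring.
have q0 : 0^' = [set [set - x | x in A] | A in (0 : K)^'] by rewrite -dnbhsN oppr0.
have cvgqN y (l : K) c : q y h @[h --> 0^'] --> l ->
    (fun h => (-1) ^+ c * q y (- h)) h @[h --> 0^'] --> (-1) ^+ c * l.
  move=> ql; apply: cvgM; first exact: cvg_cst.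
  apply: cvg_comp ql => A; rewrite /nbhs /= {1}q0 => -[B] B0 <-.
  by apply: filterS B0 => h Bh /=; exists h.
have dE y : f^`()%classic y = lim (q y h @[h --> 0^']) by [].
have sK (l : K) : l = (-1) ^+ k.+1 * ((-1) ^+ k.+1 * l).
  by rewrite mulrA -exprD addnn -mul2n exprM sqrrN expr1n expr1n mul1r.
rewrite !dE; have [ql|ndiv] := pselect (cvg (q x h @[h --> 0^'])).
  by apply: cvg_lim => //; rewrite qN; exact: cvgqN.
(* A limit that does not exist is 0 by convention; this holds at x iff at - x. *)
rewrite (dvgP ndiv) (dvgP _) /=; first by rewrite /point /= mulr0.
move=> ql; apply: ndiv; apply: (cvgP ((-1) ^+ k.+1 * lim (q (- x) h @[h --> 0^']))).
have -> : q x = (fun h => (-1) ^+ k.+1 * q (- x) (- h)); last exact: cvgqN.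
by apply/funext => h; rewrite qN opprK -sK.
Qed.

Lemma derive1n_even (K : numFieldType) (f : K -> K) (k : nat) :
  (forall x, f (- x) = f x) ->
  forall x, derive1n k f (- x) = (-1) ^+ k * derive1n k f x.
Proof.
move=> fN; elim: k => [|k IHk] x; first by rewrite expr0 mul1r /= fN.
exact: (derive1_parity IHk).
Qed.


(** * Even functions of Hamiltonian matrices *)

Section EvenFunctionOfHamiltonianMatrix.
Variables (K : numClosedFieldType) (n : nat) (S A : 'M[K]_n.+1).
Hypothesis S_unit : S \in unitmx.
Hypothesis SA : S *m A = - A^T *m S.

(** The identity S *m A = (- A)^T *m S passes from A to all polynomials in A. *)
Lemma mul_horner_mx_hamiltonian (p : {poly K}) :
  S *m horner_mx A p = (horner_mx A (p \Po - 'X))^T *m S.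
Proof.
elim/poly_ind: p => [|p c IHp].
  by rewrite comp_poly0 !rmorph0 trmx0 mulmx0 mul0mx.
rewrite comp_polyD comp_polyM comp_polyX comp_polyC !rmorphD !rmorphM rmorphN /=.
rewrite horner_mx_X horner_mx_C mulmxDr !mulmxE mulrN linearD linearN /= -!mulmxE.
have /(_ (p \Po - 'X)) -> := comm_horner_mx _ (erefl : comm_mx A A).
rewrite trmx_mul tr_scalar_mx mulmxDl mulmxA IHp -[in LHS]mulmxA SA.
by rewrite mulmxA mulmxN scalar_mxC.
Qed.

Lemma dvdp_mxminpoly_compNX (p : {poly K}) :
  mxminpoly A %| p -> mxminpoly A %| p \Po - 'X.
Proof.
rewrite !dvd_mxminpoly => /eqP pA; rewrite -trmx_eq0.
have := mul_horner_mx_hamiltonian p; rewrite pA mulmx0 => /esym.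
by move=> /(congr1 (mulmx^~ (invmx S))); rewrite /= mul0mx mulmxK // => ->.
Qed.

(** The minimal polynomial of A divides its own image under X |-> - X, so its
    roots, with multiplicities, are symmetric about 0. *)
Lemma mup_mxminpolyN (a : K) (k : nat) :
  (k < mup a (mxminpoly A))%N -> (k < mup (- a) (mxminpoly A))%N.
Proof.
have mu0 : mxminpoly A != 0 := monic_neq0 (mxminpoly_monic A).
move=> ka; rewrite mup_geq //; rewrite mup_geq // in ka.
have mua := dvdp_comp_poly (- 'X) ka.
have muN := dvdp_comp_poly (- 'X) (dvdp_mxminpoly_compNX (dvdpp _)).
rewrite comp_polyNXK in muN.
move: (dvdp_trans mua muN); rewrite rmorphXn /= comp_polyB comp_polyX comp_polyC.
rewrite -opprD exprNn polyCN opprK.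
by apply: dvdp_trans; exact: dvdp_mull.
Qed.

Lemma interpolates_even (f : K -> K) (p : {poly K}) :
  (forall x, f (- x) = f x) -> interpolates_on_spectrum f A p ->
  interpolates_on_spectrum f A (p \Po - 'X).
Proof.
move=> fN fp a k ka; rewrite derivn_comp_polyNX hornerZ horner_comp !hornerE.
rewrite fp; last exact: mup_mxminpolyN.
by rewrite derive1n_even // mulrA -exprD addnn -mul2n exprM sqrrN !expr1n mul1r.
Qed.

Lemma interpolates_horner_mx (f : K -> K) (p q : {poly K}) :
  interpolates_on_spectrum f A p -> interpolates_on_spectrum f A q ->
  horner_mx A p = horner_mx A q.
Proof.
move=> fp fq; apply/eqP; rewrite -subr_eq0 -rmorphB -dvd_mxminpoly.
apply: dvdp_hermite => [|a k ka]; first exact/monic_neq0/mxminpoly_monic.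
by rewrite derivnB hornerD hornerN fp // fq // subrr.
Qed.

(** In terms of p, the polynomial chosen in [mxfun]: p(A) = p(- A), whence
    S p(A) = p(A)^T S. If there were no interpolation polynomial, the default
    value 0 would satisfy the identity as well. *)
Lemma mul_mxfun_even (f : K -> K) : (forall x, f (- x) = f x) ->
  S *m mxfun f A = (mxfun f A)^T *m S.
Proof.
move=> fN; rewrite /mxfun.
case: xgetP => [p _ fp|_]; last by rewrite rmorph0 trmx0 mulmx0 mul0mx.
rewrite mul_horner_mx_hamiltonian.
by rewrite (interpolates_horner_mx (interpolates_even fN fp) fp).
Qed.

End EvenFunctionOfHamiltonianMatrix.

Section ZcothEven.
Variable R : realType.

Lemma ccothN (z : R[i]) : ccoth (- z) = - ccoth z.
Proof.
by rewrite /ccoth opprK addrC -[cexp (- z) - _]opprB invrN mulrN.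
Qed.

Lemma zcothN (h : R) (z : R[i]) : zcoth h (- z) = zcoth h z.
Proof.
by rewrite /zcoth oppr_eq0 mulrN !mulNr ccothN mulrN opprK.
Qed.

End ZcothEven.

Lemma skew_quadratic_form (K : numDomainType) (n : nat) (A : 'M[K]_n) (x : 'cV[K]_n) :
  A^T = - A -> x^T *m A *m x = 0.
Proof.
move=> AT; have q : (x^T *m A *m x)^T = - (x^T *m A *m x).
  by rewrite !trmx_mul trmxK AT mulNmx mulmxN mulmxA.
apply/matrixP => i j; have /matrixP/(_ j i) := q.
rewrite (ord1 i) (ord1 j) !mxE => /eqP; rewrite -addr_eq0 -mulr2n.
by rewrite mulrn_eq0 => /eqP.
Qed.

(** * Symmetry of second derivatives *)

Section Schwarz.
Variables (R : realType) (V : normedModType R).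
Implicit Types (f : V -> R) (y u v : V).

Lemma is_derive_line f y u (s : R) : derivable f (s *: u + y) u ->
  is_derive s 1 (fun t : R => f (t *: u + y)) ('D_u f (s *: u + y)).
Proof.
have qE : (fun h : R => h^-1 *: (((fun t : R => f (t *: u + y)) \o shift s) (h *: 1)
                                 - f (s *: u + y))) =
    (fun h => h^-1 *: ((f \o shift (s *: u + y)) (h *: u) - f (s *: u + y))).
  by apply/funext => h /=; rewrite scalerDl addrA -[h *: 1]/(h * 1) mulr1.
move=> df; apply: DeriveDef; first by rewrite /derivable qE.
by rewrite /derive qE.
Qed.

Lemma is_derive_translate f y u w : derivable f (w + y) u ->
  is_derive y u (fun z => f (w + z)) ('D_u f (w + y)).
Proof.
have qE : (fun h : R => h^-1 *: (((fun z => f (w + z)) \o shift y) (h *: u) - f (w + y))) =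
    (fun h => h^-1 *: ((f \o shift (w + y)) (h *: u) - f (w + y))).
  by apply/funext => h /=; rewrite addrCA.
move=> df; apply: DeriveDef; first by rewrite /derivable qE.
by rewrite /derive qE.
Qed.

Lemma mean_value_line f y u (e : R) : 0 < e ->
  (forall z, derivable f z u) ->
  exists2 s : R, s \in `]0, e[ & f (e *: u + y) - f y = 'D_u f (s *: u + y) * e.
Proof.
move=> e0 df; have dphi (s : R) := is_derive_line (df (s *: u + y)).
have cphi : {within `[0, e], continuous (fun t : R => f (t *: u + y))}.
  apply: continuous_subspaceT => s.
  by apply: differentiable_continuous; apply/derivable1_diffP; case: (dphi s).
have [s se] := MVT e0 (fun s _ => dphi s) cphi.
by rewrite scale0r add0r subr0; exists s.
Qed.

Definition square_difference f y u v (e : R) : R :=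
  f (e *: u + (e *: v + y)) - f (e *: v + y) - f (e *: u + y) + f y.

Lemma square_differenceC f y u v (e : R) :
  square_difference f y u v e = square_difference f y v u e.
Proof.
by rewrite /square_difference [e *: u + _]addrCA; congr (_ + _); rewrite addrAC.
Qed.

(** Up to the factor e ^+ 2, the second difference is a value of 'D_v ('D_u f)
    near y: the mean value theorem is applied to z |-> f (e *: v + z) - f z in the
    direction u, then to 'D_u f in the direction v. *)
Lemma mean_value_square f y u v (e : R) : 0 < e ->
  (forall z, derivable f z u) -> (forall z, derivable ('D_u f) z v) ->
  exists s t : R, [/\ s \in `]0, e[, t \in `]0, e[ &
    square_difference f y u v e = 'D_v ('D_u f) (t *: v + (s *: u + y)) * e ^+ 2].
Proof.
move=> e0 df ddf; pose g z := f (e *: v + z) - f z.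
have dg z : is_derive z u g ('D_u f (e *: v + z) - 'D_u f z).
  apply: is_deriveB; last exact: derivableP.
  exact: is_derive_translate.
have [s se gs] := mean_value_line y e0 (fun z => @ex_derive _ _ _ _ _ _ _ (dg z)).
have [t te ft] := mean_value_line (s *: u + y) e0 ddf.
exists s, t; split => //; rewrite expr2 mulrA -ft -(@derive_val _ _ _ _ _ _ _ (dg _)) -gs.
rewrite /g /square_difference [e *: v + (e *: u + y)]addrCA.
by move: (f _) (f _) (f _) (f _) => a b c d; ring.
Qed.

(** Schwarz's theorem: [square_difference] is symmetric in u and v, so by
    [mean_value_square] both mixed derivatives take a common value at points
    arbitrarily near y, and they are continuous. *)
Lemma derive_comm f u v :
  (forall z, derivable f z u) -> (forall z, derivable f z v) ->
  (forall z, derivable ('D_u f) z v) -> (forall z, derivable ('D_v f) z u) ->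
  continuous ('D_v ('D_u f)) -> continuous ('D_u ('D_v f)) ->
  forall y, 'D_v ('D_u f) y = 'D_u ('D_v f) y.
Proof.
move=> fu fv fuv fvu cuv cvu y.
apply/eqP; rewrite -subr_eq0 -normr_le0; apply/ler_addgt0Pl => d d0; rewrite addr0.
have d2 : 0 < d / 2 by rewrite divr_gt0.
have /nbhs_ballP[r /= r0 yr] : \forall z \near y,
    `|'D_v ('D_u f) y - 'D_v ('D_u f) z| < d / 2 /\
    `|'D_u ('D_v f) y - 'D_u ('D_v f) z| < d / 2.
  have /cvgrPdist_lt/(_ _ d2) cu := cuv y; have /cvgrPdist_lt/(_ _ d2) cv := cvu y.
  exact: filterI cu cv.
(* With this side e, the whole parallelogram lies in the ball of radius r. *)
pose e := r / (`|u| + `|v| + 1).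
have w0 : 0 < `|u| + `|v| + 1 by rewrite ltr_wpDl // addr_ge0.
have e0 : 0 < e by rewrite divr_gt0.
have small (a b : V) (s t : R) : `|a| + `|b| = `|u| + `|v| ->
    s \in `]0, e[ -> t \in `]0, e[ -> ball y r (t *: b + (s *: a + y)).
  rewrite !in_itv /= => ab /andP[s0 se] /andP[t0 te]; rewrite -ball_normE /= distrC.
  rewrite addrA addrK (le_lt_trans (ler_normD _ _)) // !normrZ !gtr0_norm //.
  apply: (@le_lt_trans _ _ (e * (`|u| + `|v|))).
    by rewrite -ab addrC mulrDr lerD // ler_wpM2r // ltW.
  by rewrite /e mulrAC ltr_pdivrMr // ltr_pM2l // ltrDl.
(* The points where the two mixed derivatives agree. *)
have [s [t [se te suv]]] := mean_value_square y e0 fu fuv.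
have [s' [t' [se' te' svu]]] := mean_value_square y e0 fv fvu.
have [uvd _] := yr _ (small _ _ _ _ erefl se te).
have [_ vud] := yr _ (small _ _ _ _ (addrC _ _) se' te').
have eq_z : 'D_v ('D_u f) (t *: v + (s *: u + y)) =
    'D_u ('D_v f) (t' *: u + (s' *: v + y)).
  apply: (@mulIf _ (e ^+ 2)); first by rewrite expf_neq0 // gt_eqF.
  exact: etrans (esym suv) (etrans (square_differenceC _ _ _ _ _) svu).
rewrite -eq_z in vud; rewrite [d]splitr.
apply: le_trans (ler_distD _ _ _) (lerD (ltW uvd) _).
by rewrite distrC; exact: ltW.
Qed.

End Schwarz.

(** * Hessian, discrete gradient and energy *)

Lemma hessian_sym (R : realType) (n : nat) (H : 'cV[R]_n -> R) (y : 'cV[R]_n) :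
  smooth H -> (hessian H y)^T = hessian H y.
Proof.
move=> sH; apply/matrixP => j k; rewrite !mxE.
have d1 (i : 'I_n) z : derivable H z (delta_mx i 0) := (sH [::]).2 i z.
have d2 (i l : 'I_n) z : derivable ('D_(delta_mx l 0) H) z (delta_mx i 0) :=
  (sH [:: l]).2 i z.
have c2 (i l : 'I_n) : continuous ('D_(delta_mx i 0) ('D_(delta_mx l 0) H)) :=
  (sH [:: i; l]).1.
exact: (derive_comm (d1 j) (d1 k) (d2 k j) (d2 j k) (c2 k j) (c2 j k)).
Qed.

Lemma skew_hessianT (R : realType) (n : nat) (H : 'cV[R]_n -> R) (y : 'cV[R]_n) :
  smooth H -> (skew_hessian H y)^T = - skew_hessian H y.
Proof.
move=> sH; apply/matrixP => j k; have /matrixP/(_ j k) := hessian_sym y sH.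
rewrite [(hessian H y)^T _ _]mxE /skew_hessian => hE.
rewrite [LHS]mxE mxE [RHS]mxE [in RHS]mxE.
by case: (ltngtP j k) => _ /=; rewrite ?hE ?opprK ?oppr0.
Qed.

(** The j-th summand is H (mixed_point j.+1) - H (mixed_point j), also when
    y1 j = y0 j, where these two points coincide; the sum telescopes. *)
Lemma coord_increment_dgradP (R : realType) (n : nat) (H : 'cV[R]_n -> R)
    (y0 y1 : 'cV[R]_n) :
  (y1 - y0)^T *m coord_increment_dgrad H y0 y1 = (H y1 - H y0)%:M.
Proof.
apply/matrixP => i j; rewrite !ord1 !mxE mulr1n.
pose P k := H (mixed_point y0 y1 k).
rewrite (eq_bigr (fun k : 'I_n => P k.+1 - P k)) => [|k _].
  rewrite -(big_mkord xpredT (fun k => P k.+1 - P k)) telescope_sumr // /P.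
  by congr (H _ - H _); apply/colP => k; rewrite mxE ?ltn_ord.
rewrite !mxE; case: eqP => [yk|/eqP yk]; last first.
  by rewrite mulrC divfK // subr_eq0.
rewrite yk subrr mul0r /P; apply/esym/eqP; rewrite subr_eq0; apply/eqP; congr H.
apply/colP => l; rewrite !mxE ltnS.
by case: ltngtP => // /val_inj ->.
Qed.

Lemma mul_symplectic_mx (R : realType) (m : nat) :
  symplectic_mx R m *m symplectic_mx R m = - 1%:M.
Proof.
rewrite /symplectic_mx mulmx_block !mul0mx !mulmx0 !mulmx1 !mul1mx !add0r !addr0.
by rewrite (scalar_mx_block m m 1) opp_block_mx oppr0.
Qed.

Lemma tr_symplectic_mx (R : realType) (m : nat) :
  (symplectic_mx R m)^T = - symplectic_mx R m.
Proof.
by rewrite /symplectic_mx tr_block_mx opp_block_mx !linear0 linearN /= trmx1 opprK.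
Qed.

Theorem proposition4p12 (R : realType) (m : nat)
    (H : 'cV[R]_(m.+1 + m.+1) -> R) (ybar y0 y1 : 'cV[R]_(m.+1 + m.+1)) (h : R) :
  smooth H ->
  0 < h ->
  theta_defined H h ybar ->
  dg_scheme H h ybar y0 y1 ->
  H y1 = H y0.
Proof.
move=> sH _ [_ uD]; rewrite /dg_scheme /theta.
set D := theta_denom H h ybar in uD *; set g := coord_increment_dgrad H y0 y1.
set d := y1 - y0 => scheme.
pose S := complexify (symplectic_mx R m.+1).
pose A := complexify (hamiltonian_jacobi H ybar).
pose Rc := complexify (skew_hessian H ybar).
pose M := mxfun (zcoth h) A.
have SS : S *m S = - 1%:M.
  by rewrite -map_mxM mul_symplectic_mx map_mxN map_mx1.
have ST : S^T = - S by rewrite map_trmx tr_symplectic_mx map_mxN.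
have Su : S \in unitmx.
  by case: (@mulmx1_unit _ _ S (- S)) => //; rewrite mulmxN SS opprK.
have SA : S *m A = - A^T *m S.
  rewrite /A /hamiltonian_jacobi /complexify map_mxM -/S mulmxA SS.
  rewrite trmx_mul ST !map_trmx hessian_sym //.
  by rewrite mulmxN opprK -mulmxA SS mulmxN mulNmx mul1mx mulmx1.
have RT : Rc^T = - Rc by rewrite map_trmx skew_hessianT // map_mxN.
have BT : (Rc - S *m M)^T = - (Rc - S *m M).
  rewrite linearB /= RT trmx_mul ST mulmxN.
  by rewrite (mul_mxfun_even Su SA (@zcothN _ h)) opprK opprB addrC.
(* The scheme, solved for the discrete gradient. *)
have gE : 2 *: complexify g = (Rc - S *m M) *m complexify d.
  have : D *m complexify d = 2 *: (S *m complexify g).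
    rewrite scheme -scalemxAl -scalemxAr mulmxA mulmxV // mul1mx.
    by rewrite /complexify map_mxM.
  move=> /(congr1 (mulmx (- S))).
  have -> : - S *m (2 *: (S *m complexify g)) = 2 *: complexify g.
    by rewrite -scalemxAr mulmxA mulNmx SS opprK mul1mx.
  move=> <-; rewrite mulmxA /D /theta_denom mulmxDr /complexify map_mxM -/S -/Rc -/A -/M.
  by rewrite !mulNmx mulmxA SS mulNmx mul1mx opprK.
have dg0 : (complexify d)^T *m (2 *: complexify g) = 0.
  by rewrite gE mulmxA skew_quadratic_form.
move: dg0; rewrite -scalemxAr /complexify map_trmx -map_mxM coord_increment_dgradP.
move=> /matrixP/(_ 0 0); rewrite !mxE mulr1n => /eqP.
rewrite mulf_eq0 pnatr_eq0 /= -[0]/(0%:C) => /eqP/complexI/eqP.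
by rewrite subr_eq0 => /eqP.
Qed.
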